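(* Let $G$ be a finite, undirected, simple $d$-regular graph on $n\geq 1$ vertices. Then, for every real $\lambda>0$, $$V_G(\lambda)\;\geq\; V_{K_{d+1}}(\lambda)=\frac{\lambda}{\bigl(1+(d+1)\lambda\bigr)^2},$$ with equality if and only if $G$ is a disjoint union of copies of $K_{d+1}$.
   Context: All graphs are finite, undirected and simple, with at least one vertex. $K_m$ denotes the complete graph on $m$ vertices. For a graph $G$ on $n$ vertices, $\mathcal{I}(G)$ is the set of all independent sets of $G$ (including the empty set), and the independence polynomial (partition function of the hard-core model) is $P_G(\lambda)=\sum_{I\in\mathcal{I}(G)}\lambda^{|I|}$ for $\lambda>0$. The hard-core model on $G$ at fugacity $\lambda$ is the probability measure on $\mathcal{I}(G)$ given by $\Pr[I]=\lambda^{|I|}/P_G(\lambda)$. The free energy density is $F_G(\lambda)=\frac1n\log P_G(\lambda)$, the occupancy fraction is $E_G(\lambda)=\lambda\frac{\partial}{\partial\lambda}F_G(\lambda)$, and the variance fraction is $V_G(\lambda)=\lambda\frac{\partial}{\partial\lambda}E_G(\lambda)$. Equivalently, $nE_G(\lambda)=\mathbb{E}(|I|)$ and $nV_G(\lambda)=\operatorname{Var}(|I|)$, where $I$ is drawn from the hard-core model on $G$ at fugacity $\lambda$. *)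

(* Defs.v *)
From HB Require Import structures.
From mathcomp Require Import all_boot all_order all_algebra.
From mathcomp Require Import all_classical all_reals all_analysis.
Import Order.TTheory GRing.Theory Num.Theory.
Import numFieldNormedType.Exports.
Set Implicit Arguments.
Unset Strict Implicit.
Unset Printing Implicit Defensive.

Local Open Scope ring_scope.

Record sgraph := SGraph {
  vertex :> finType;
  adj : rel vertex;
  adj_sym : symmetric adj;
  adj_irrefl : irreflexive adj }.

Definition regular (d : nat) (G : sgraph) : Prop :=
  forall x : G, #|[set y : G | adj x y]| = d.

Definition isomorphic (G H : sgraph) : Prop :=
  exists2 f : G -> H, bijective f & forall x y : G, adj (f x) (f y) = adj x y.

Lemma neq_symmetric (T : eqType) : symmetric (fun x y : T => x != y).
Proof. by move=> x y; rewrite eq_sym. Qed.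

Lemma neq_irreflexive (T : eqType) : irreflexive (fun x y : T => x != y).
Proof. by move=> x; rewrite eqxx. Qed.

Definition complete_graph (m : nat) : sgraph :=
  SGraph (@neq_symmetric 'I_m) (@neq_irreflexive 'I_m).

Section Copies.
Variables (k : nat) (G : sgraph).

Definition copies_adj : rel ('I_k * G)%type :=
  fun u v => (u.1 == v.1) && adj u.2 v.2.

Lemma copies_adj_sym : symmetric copies_adj.
Proof. by move=> u v; rewrite /copies_adj eq_sym adj_sym. Qed.

Lemma copies_adj_irrefl : irreflexive copies_adj.
Proof. by move=> u; rewrite /copies_adj adj_irrefl andbF. Qed.

Definition copies : sgraph := SGraph copies_adj_sym copies_adj_irrefl.

End Copies.

Definition indep_sets (G : sgraph) : {set {set G}} :=
  [set I : {set G} | [forall x in I, forall y in I, ~~ adj x y]].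

Section HardCore.
Variables (R : realType) (G : sgraph).

Definition indep_poly (lam : R) : R :=
  \sum_(I in indep_sets G) lam ^+ #|I|.

(* The model is defined for lam > 0 only. The functions below are total, but
   derivatives are local, so their values at lam > 0 depend only on the
   values of the independence polynomial at positive arguments. *)
Definition free_energy_density (lam : R) : R :=
  (#|G|%:R)^-1 * ln (indep_poly lam).

Definition occupancy_fraction (lam : R) : R :=
  lam * derive1 free_energy_density lam.

Definition variance_fraction (lam : R) : R :=
  lam * derive1 occupancy_fraction lam.

End HardCore.

(* Main.v *)
Require Import Defs.
From HB Require Import structures.
From mathcomp Require Import all_boot all_order all_algebra.
From mathcomp Require Import all_classical all_reals all_analysis.
From mathcomp Require Import ring lra.
Import Order.TTheory GRing.Theory Num.Theory.
Import numFieldNormedType.Exports.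
Local Open Scope ring_scope.

(** For a random independent set I let X = |I| and let W be the number of
    vertices v whose closed neighbourhood misses I, i.e. which can be added to
    I. The pairs (J, v in J) correspond to the pairs (I, v addable to I) through
    J = I + v, so that E[X f(I)] = lam E[sum over addable v of f(I + v)].
    Taking f = 1, X, W and using W(I + v) >= W(I) - (d + 1) bounds the second
    moment of W. With t = (d + 1) lam, the inequality Var(lam W + t X) >= 0
    then gives (1 + t) Var X >= E X, while W >= n - (d + 1) X gives
    (1 + t) E X >= lam n. Equality forces W = n - (d + 1) X for every
    independent set; for I = {x, z} this rules out a common neighbour of
    nonadjacent x and z, so adjacency is transitive on distinct vertices.
    Conversely W = n - (d + 1) X determines the first two moments of X. *)

(** * Closed neighbourhoods, uncovered vertices and cluster graphs *)

Definition closed_nbhd (G : sgraph) (x : G) : {set G} :=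
  x |: [set y | adj x y].

Definition uncovered (G : sgraph) (I : {set G}) : {set G} :=
  [set v | [disjoint closed_nbhd G v & I]].

(** Local form of being a disjoint union of complete graphs: no induced path on three vertices. *)
Definition cluster_graph (G : sgraph) : Prop :=
  forall x y z : G, adj x y -> adj y z -> x != z -> adj x z.

Section Graph.
Variable G : sgraph.
Implicit Types (x y v : G) (I : {set G}).
Local Notation N := (@closed_nbhd G).
Local Notation U := (@uncovered G).

Lemma in_closed_nbhd x y : (y \in N x) = (y == x) || adj x y.
Proof. by rewrite !inE. Qed.

Lemma closed_nbhd_sym x y : (y \in N x) = (x \in N y).
Proof. by rewrite !in_closed_nbhd eq_sym adj_sym. Qed.

Lemma card_closed_nbhd d x : regular d G -> #|N x| = d.+1.
Proof. by move=> reg; rewrite cardsU1 inE adj_irrefl reg. Qed.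

Lemma indep_setsP I :
  reflect {in I &, forall x y, ~~ adj x y} (I \in indep_sets G).
Proof.
rewrite inE; apply: (iffP forall_inP) => [h x y xI yI|h x xI].
  by have /forall_inP := h x xI; apply.
by apply/forall_inP => y yI; apply: h.
Qed.

Lemma uncoveredP v I : reflect {in I, forall x, x \notin N v} (v \in U I).
Proof.
rewrite inE disjoint_sym disjoint_subset.
by apply: (iffP fintype.subsetP) => h x /h.
Qed.

Lemma card_setU1_uncovered v I : v \in U I -> #|v |: I| = #|I|.+1.
Proof.
move=> /uncoveredP vI; rewrite cardsU1; case: (boolP (v \in I)) => [/vI|//].
by rewrite in_closed_nbhd eqxx.
Qed.

(** The left side is the range condition that reindexing by [J = v |: I] produces; its second
    conjunct encodes [v \notin I]. *)
Lemma indep_setU1 v I :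
  (v |: I \in indep_sets G) && ((v |: I) :\ v == I) =
  (I \in indep_sets G) && (v \in U I).
Proof.
apply/andP/andP =>
  [[/indep_setsP indI /eqP E]|[/indep_setsP indI /uncoveredP vI]].
  have vI : v \notin I by rewrite -E !inE eqxx.
  split.
    by apply/indep_setsP => x y xI yI; apply: indI; rewrite !inE ?xI ?yI orbT.
  apply/uncoveredP => x xI; rewrite in_closed_nbhd negb_or.
  rewrite indI ?andbT ?inE ?eqxx ?xI ?orbT //.
  by apply: contraNN vI => /eqP <-.
split; last first.
  by apply/eqP/setU1K/negP => /vI; rewrite in_closed_nbhd eqxx.
have vadj x : x \in I -> ~~ adj v x.
  by move=> /vI; rewrite in_closed_nbhd negb_or => /andP[].
apply/indep_setsP => x y; rewrite !inE => /predU1P[->|xI] /predU1P[->|yI].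
- by rewrite adj_irrefl.
- exact: vadj.
- by rewrite adj_sym vadj.
- exact: indI.
Qed.

(** Double counting of the pairs [(v, x)] with [x] in both [I] and [N v]. *)
Lemma sum_card_closed_nbhd d I : regular d G ->
  (\sum_v #|N v :&: I| = d.+1 * #|I|)%N.
Proof.
move=> reg; transitivity (\sum_v \sum_(x in I) (x \in N v))%N.
  apply: eq_bigr => v _; rewrite -sum1_card big_mkcond [RHS]big_mkcond /=.
  by apply: eq_bigr => x _; rewrite inE; case: (x \in I); case: (x \in N v).
rewrite exchange_big mulnC -sum_nat_const; apply: eq_bigr => x _ /=.
rewrite -(card_closed_nbhd d x reg) -sum1_card [RHS]big_mkcond /=.
by apply: eq_bigr => v _; rewrite closed_nbhd_sym; case: ifP.
Qed.

Lemma card_uncovered_sum I : #|U I| = (\sum_v (N v :&: I == finset.set0))%N.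
Proof.
rewrite -sum1_card big_mkcond; apply: eq_bigr => v _.
by rewrite inE -setI_eq0; case: eqP.
Qed.

(** With [k = #|N v :&: I|], each vertex satisfies 1 <= [k = 0] + k, with equality iff k <= 1;
    summing over [v] gives both the bound and its equality case. *)
Lemma card_uncovered_ge d I : regular d G ->
  (#|G| <= #|U I| + d.+1 * #|I| ?= iff [forall v, #|N v :&: I| <= 1])%N.
Proof.
move=> reg.
rewrite -(sum_card_closed_nbhd d I reg) card_uncovered_sum -big_split /=.
rewrite -sum1_card; apply: leqif_sum => v _ /=.
by rewrite -cards_eq0; case: #|_| => [|[|m]]; split.
Qed.

(** Two distinct elements of [I] in one closed neighbourhood [N v] would be adjacent, directly or
    through [v]. *)
Lemma card_uncovered_cluster d I : regular d G -> cluster_graph G ->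
  I \in indep_sets G -> (#|U I| + d.+1 * #|I| = #|G|)%N.
Proof.
move=> reg clG /indep_setsP indI; apply/eqP.
rewrite eq_sym (card_uncovered_ge d I reg).
apply/forallP => v; rewrite leqNgt; apply/negP => /card_gt1P[x [y [+ + xy]]].
rewrite !inE => /andP[xv xI] /andP[yv yI].
suff : adj x y by apply/negP/indI.
case/predU1P: xv xy => [->|xv] xy; case/predU1P: yv xy => [->|yv] xy.
- by rewrite eqxx in xy.
- by [].
- by rewrite adj_sym.
- by apply: (clG x v y); rewrite ?(adj_sym x).
Qed.

Lemma cluster_of_card_uncovered d : regular d G ->
  (forall I, I \in indep_sets G -> #|U I| + d.+1 * #|I| = #|G|)%N ->
  cluster_graph G.
Proof.
move=> reg h x y z xy yz xz; apply: contraT => nxz.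
have indI : [set x; z] \in indep_sets G.
  apply/indep_setsP => a b; rewrite !inE => /orP[] /eqP-> /orP[] /eqP->.
  - by rewrite adj_irrefl.
  - by [].
  - by rewrite adj_sym.
  - by rewrite adj_irrefl.
have /eqP := h _ indI; rewrite eq_sym (card_uncovered_ge d _ reg).
move=> /forallP/(_ y).
rewrite leqNgt => /negP[]; apply/card_gt1P; exists x, z; split => //.
- by rewrite !inE eqxx (adj_sym y) xy orbT.
- by rewrite !inE eqxx yz !orbT.
Qed.

(** Only vertices of [N v] can stop being uncovered when [v] is added. *)
Lemma uncovered_setU1 d v I : regular d G ->
  (#|U I| <= #|U (v |: I)| + d.+1)%N.
Proof.
move=> reg; rewrite -(card_closed_nbhd d v reg) addnC.
apply: leq_trans (leq_card_setU _ _).1; apply: subset_leq_card.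
apply/fintype.subsetP => x /uncoveredP xI; rewrite finset.in_setU.
case: (boolP (x \in N v)) => //= xv; apply/uncoveredP => y.
by rewrite finset.in_setU1 => /predU1P[->|/xI//]; rewrite closed_nbhd_sym.
Qed.

End Graph.

(** * Weighted sums over independent sets *)

Section Moments.
Variables (R : realType) (G : sgraph) (lam : R).
Implicit Types (f g : {set G} -> R).
Local Notation U := (@uncovered G).

(** The unnormalised expectation: dividing by [indep_poly] gives the hard-core mean of [f]. *)
Definition wsum f : R := \sum_(I in indep_sets G) lam ^+ #|I| * f I.

Lemma wsum_indep_poly : wsum (fun=> 1) = indep_poly G lam.
Proof. by apply: eq_bigr => I _; rewrite mulr1. Qed.

Lemma eq_wsum f g : {in indep_sets G, f =1 g} -> wsum f = wsum g.
Proof. by move=> fg; apply: eq_bigr => I /fg ->. Qed.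

Lemma wsumD f g : wsum (fun I => f I + g I) = wsum f + wsum g.
Proof. by rewrite -big_split; apply: eq_bigr => I _; rewrite mulrDr. Qed.

Lemma wsumZ (a : R) f : wsum (fun I => a * f I) = a * wsum f.
Proof. by rewrite mulr_sumr; apply: eq_bigr => I _; rewrite mulrCA. Qed.

Lemma wsum_switch f :
  wsum (fun J => #|J|%:R * f J) =
  lam * wsum (fun I => \sum_(v in U I) f (v |: I)).
Proof.
transitivity (\sum_(J in indep_sets G) \sum_(v in J) lam ^+ #|J| * f J).
  by apply: eq_bigr => J _; rewrite sumr_const -mulr_natl; ring.
transitivity (\sum_(I in indep_sets G) \sum_(v in U I)
    lam ^+ #|I|.+1 * f (v |: I)); last first.
  rewrite mulr_sumr; apply: eq_bigr => I _.
  by rewrite mulrA -exprS mulr_sumr.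
rewrite (exchange_big_dep xpredT) //= [RHS](exchange_big_dep xpredT) //=.
apply: eq_bigr => v _.
(* For fixed [v], adding [v] and removing [v] are inverse bijections between the sets [I] that [v]
   can extend and the sets [J] containing [v]. *)
rewrite (reindex_onto (fun I => v |: I) (fun J => J :\ v)) /=; last first.
  by move=> J /andP[_ vJ]; rewrite finset.setD1K.
under eq_bigl do rewrite setU11 andbT indep_setU1.
by apply: eq_bigr => I /andP[_ vI]; rewrite card_setU1_uncovered.
Qed.

Hypothesis lam_gt0 : 0 < lam.

Lemma wsum_ge0 f : {in indep_sets G, forall I, 0 <= f I} -> 0 <= wsum f.
Proof.
by move=> f0; apply: sumr_ge0 => I /f0; apply: mulr_ge0; rewrite exprn_ge0 ?ltW.
Qed.

Lemma ler_wsum f g :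
  {in indep_sets G, forall I, f I <= g I} -> wsum f <= wsum g.
Proof.
by move=> fg; apply: ler_sum => I /fg; apply: ler_wpM2l; rewrite exprn_ge0 ?ltW.
Qed.

Lemma indep_poly_gt0 : 0 < indep_poly G lam.
Proof.
rewrite /indep_poly (bigD1 finset.set0) /=; last first.
  by apply/indep_setsP => x y; rewrite inE.
rewrite cards0 expr0 ltr_pwDl // sumr_ge0 // => I _.
by rewrite exprn_ge0 // ltW.
Qed.

(** Nonnegativity of the variance of [f], with denominators cleared. *)
Lemma wsum_cauchy f :
  wsum f ^+ 2 <= indep_poly G lam * wsum (fun I => f I ^+ 2).
Proof.
set Z := indep_poly G lam; set m := wsum f.
have : 0 <= wsum (fun I => (Z * f I - m) ^+ 2).
  by apply: wsum_ge0 => I _; rewrite sqr_ge0.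
have -> : wsum (fun I => (Z * f I - m) ^+ 2) =
    Z * (Z * wsum (fun I => f I ^+ 2) - m ^+ 2).
  transitivity (wsum (fun I =>
      Z ^+ 2 * f I ^+ 2 + ((- 2 * Z * m) * f I + m ^+ 2 * 1))).
    by apply: eq_wsum => I _; ring.
  by rewrite !wsumD !wsumZ wsum_indep_poly -/m -/Z; ring.
by rewrite pmulr_rge0 ?indep_poly_gt0 // subr_ge0.
Qed.

End Moments.

(** * Regular cluster graphs are disjoint unions of complete graphs *)

Lemma complete_graph_regular d : regular d (complete_graph d.+1).
Proof.
move=> x; rewrite (_ : [set y | _] = [set~ x]); last first.
  by apply/setP => y; rewrite !inE eq_sym.
by rewrite cardsC1 card_ord.
Qed.

Lemma complete_graph_cluster m : cluster_graph (complete_graph m).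
Proof. by []. Qed.

Lemma copies_cluster k G : cluster_graph G -> cluster_graph (copies k G).
Proof.
move=> clG x y z /andP[/eqP xy axy] /andP[/eqP yz ayz] xz.
rewrite /= /copies_adj xy yz eqxx; apply: clG axy ayz _.
by apply: contraNneq xz => e; rewrite -pair_eqE /pair_eq e xy yz !eqxx.
Qed.

Lemma isomorphic_cluster G H :
  isomorphic G H -> cluster_graph H -> cluster_graph G.
Proof.
case=> f /bij_inj finj fadj clH x y z; rewrite -!fadj => xy yz xz.
by apply: clH xy yz _; rewrite (inj_eq finj).
Qed.

Lemma closed_nbhd_eq G x y : cluster_graph G ->
  (closed_nbhd G x == closed_nbhd G y) = (y \in closed_nbhd G x).
Proof.
move=> clG; apply/eqP/idP => [->|]; first by rewrite in_closed_nbhd eqxx.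
rewrite in_closed_nbhd => /predU1P[->//|xy].
have sub a b : adj a b -> closed_nbhd G a \subset closed_nbhd G b.
  move=> ab; apply/fintype.subsetP => z; rewrite !in_closed_nbhd.
  case/predU1P=> [->|az]; first by rewrite adj_sym ab orbT.
  have [//|zb] := eqVneq z b; rewrite (clG b a z) //; first by rewrite adj_sym.
  by rewrite eq_sym.
by apply/eqP; rewrite finset.eqEsubset !sub // adj_sym.
Qed.

(** The distinct closed neighbourhoods are the cliques. A vertex is sent to the rank of its clique
    and to its position in the enumeration of that clique. *)
Lemma cluster_isomorphic d G : regular d G -> cluster_graph G ->
  exists k, isomorphic G (copies k (complete_graph d.+1)).
Proof.
move=> reg clG; set N := closed_nbhd G.
pose P := N @: [set: G].
have NP x : N x \in P by apply: imset_f; rewrite finset.in_setT.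
have self x : x \in N x by rewrite in_closed_nbhd eqxx.
have idx x : (index x (enum (N x)) < d.+1)%N.
  by rewrite -(card_closed_nbhd G d x reg) cardE index_mem mem_enum.
pose f x : copies #|P| (complete_graph d.+1) :=
  (enum_rank_in (NP x) (N x), Ordinal (idx x)).
have f1 x y : ((f x).1 == (f y).1) = (N x == N y).
  apply/eqP/eqP => [/= e|e].
    by rewrite -(enum_rankK_in (NP x) (NP x)) e enum_rankK_in.
  by apply: enum_val_inj; rewrite !enum_rankK_in.
have finj : injective f.
  move=> x y e; have /eqP Nxy : N x == N y by rewrite -f1 e.
  have /(congr1 val) /= ixy : (f x).2 = (f y).2 by rewrite e.
  rewrite Nxy in ixy.
  rewrite -[x](@nth_index _ x x (enum (N y))) ?mem_enum -?Nxy //.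
  by rewrite Nxy ixy nth_index ?mem_enum.
exists #|P|, f; last first.
  move=> x y; rewrite /= /copies_adj f1 closed_nbhd_eq // in_closed_nbhd.
  have [->|yx] := eqVneq y x; first by rewrite !adj_irrefl andbF.
  rewrite /=; case: (boolP (adj x y)) => //= xy.
  apply: contra_neq yx => /(congr1 val) /= e.
  have /eqP Nxy : N x == N y.
    by rewrite closed_nbhd_eq // in_closed_nbhd xy orbT.
  apply: finj; apply/eqP; rewrite -pair_eqE /pair_eq f1 Nxy eqxx /=.
  by rewrite -val_eqE /= e.
(* Surjectivity comes from counting: the cliques partition the vertices into [#|P|] blocks of size
   [d.+1]. *)
apply: inj_card_bij finj _ => /=; rewrite card_prod !card_ord.
rewrite -cardsT (@card_uniform_partition _ d.+1 P) //.
  by move=> _ /imsetP[x _ ->]; apply: card_closed_nbhd.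
suff -> : P = equivalence_partition (fun x y => y \in N x) [set: G].
  apply: equivalence_partitionP => x y z _ _ _; split => // xy.
  by have /eqP -> : N x == N y by rewrite closed_nbhd_eq.
by apply: eq_imset => x; apply/setP => y; rewrite !inE.
Qed.

(** * Logarithmic derivatives and the variance formula *)

(** Closed formulas are available only at positive arguments; these contain a neighbourhood of [x],
    which is enough for a derivative. *)
Lemma derive1_near (R : realType) (f g : R -> R) (x dg : R) : 0 < x ->
  (forall y, 0 < y -> f y = g y) -> is_derive x 1 g dg -> derive1 f x = dg.
Proof.
move=> x0 fg dgx; rewrite derive1E; apply: derive_val.
apply: near_eq_is_derive dgx.
by near=> y; apply/esym/fg; near: y; exact: lt_nbhsr.
Unshelve. all: by end_near. Qed.

Section LogDerivative.
Variables (R : realType) (p : {poly R}) (c : R).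
Hypothesis p_gt0 : forall x, 0 < x -> 0 < p.[x].
(** The operator x d/dx multiplies the coefficient of degree k by k, so [q] and [r] will carry the
    first and second moments of the size. *)
Let q := 'X * p^`().
Let r := 'X * q^`().

Lemma log_derivative (F : R -> R) (x : R) : 0 < x ->
  (forall y, 0 < y -> F y = c * ln p.[y]) ->
  x * derive1 F x = c * (q.[x] / p.[x]).
Proof.
move=> x0 FE.
have dln : is_derive x 1 (@ln R \o horner p) (p.[x]^-1 * p^`().[x]).
  by apply: is_derive1_comp; apply: is_derive1_ln; apply: p_gt0.
rewrite (@derive1_near _ _ (c \*: (@ln R \o horner p)) _ _ x0 FE
  (is_deriveZ _ _)).
by rewrite /q !hornerE /GRing.scale /=; ring.
Qed.

(** Quotient rule: x (q/p)' = x q'/p - q (x p')/p^2, where x q' = r and x p' = q. *)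
Lemma log_derivative2 (E : R -> R) (x : R) : 0 < x ->
  (forall y, 0 < y -> E y = c * (q.[y] / p.[y])) ->
  x * derive1 E x = c * (r.[x] / p.[x] - (q.[x] / p.[x]) ^+ 2).
Proof.
move=> x0 EE; have px0 : p.[x] != 0 by rewrite gt_eqF // p_gt0.
have dinv : is_derive x 1 (fun y => (p.[y])^-1) (- p.[x] ^- 2 *: p^`().[x]).
  exact: is_deriveV.
rewrite (@derive1_near _ _ (c \*: (horner q * (fun y => (p.[y])^-1))) _ _ x0 EE
  (is_deriveZ _ _)).
rewrite /r /q !hornerE /GRing.scale /=.
by field.
Qed.

End LogDerivative.

Section Variance.
Variables (R : realType) (G : sgraph).

(** Stated for arbitrary coefficients so that it can be applied twice, first to 1 and then to
    [#|I|]. *)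
Lemma mulX_deriv_wsum (a b : {set G} -> R) :
  (forall I, b I = #|I|%:R * a I) ->
  'X * (\sum_(I in indep_sets G) a I *: 'X^(#|I|))^`() =
  \sum_(I in indep_sets G) b I *: 'X^(#|I|).
Proof.
move=> ba; rewrite linear_sum mulr_sumr; apply: eq_bigr => I _.
rewrite /= derivZ derivXn -scalerAr ba.
case: #|I| => [|k]; first by rewrite mulr0n mulr0 scaler0 mul0r scale0r.
by rewrite mulrnAr -exprS -scaler_nat scalerA mulrC.
Qed.

Lemma horner_wsum (a : {set G} -> R) (x : R) :
  (\sum_(I in indep_sets G) a I *: 'X^(#|I|)).[x] = wsum R G x a.
Proof.
rewrite horner_sum; apply: eq_bigr => I _.
by rewrite hornerZ hornerXn mulrC.
Qed.

Lemma variance_fractionE (lam : R) : 0 < lam ->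
  variance_fraction G lam = #|G|%:R^-1 *
    (wsum R G lam (fun I => #|I|%:R ^+ 2) / indep_poly G lam -
     (wsum R G lam (fun I => #|I|%:R) / indep_poly G lam) ^+ 2).
Proof.
move=> lam0; pose p : {poly R} := \sum_(I in indep_sets G) 1 *: 'X^(#|I|).
have pE x : p.[x] = indep_poly G x by rewrite horner_wsum wsum_indep_poly.
have p0 x : 0 < x -> 0 < p.[x] by rewrite pE; apply: indep_poly_gt0.
have qE : 'X * p^`() = \sum_(I in indep_sets G) #|I|%:R *: 'X^(#|I|).
  by apply: mulX_deriv_wsum => I; rewrite mulr1.
have rE : 'X * ('X * p^`())^`() =
    \sum_(I in indep_sets G) #|I|%:R ^+ 2 *: 'X^(#|I|).
  by rewrite qE; apply: mulX_deriv_wsum => I; rewrite expr2.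
rewrite /variance_fraction (@log_derivative2 _ p #|G|%:R^-1) //.
  by rewrite rE qE !horner_wsum wsum_indep_poly.
move=> y y0; rewrite /occupancy_fraction (@log_derivative _ p #|G|%:R^-1) //.
by move=> z _; rewrite /free_energy_density pE.
Qed.

End Variance.

(** * The variance bound and its equality case *)

Section Inequality.
Variables (R : realType) (d : nat) (G : sgraph).
Hypothesis regG : regular d G.
Variable (lam : R).
Hypothesis lam_gt0 : 0 < lam.
Local Notation W I := (#|uncovered G I|%:R : R).
Local Notation X I := (#|I|%:R : R).
Local Notation S := (wsum R G lam).
Local Notation Z := (indep_poly G lam).
Local Notation M1 := (S (fun I => X I)).
Local Notation M2 := (S (fun I => X I ^+ 2)).
Local Notation D := (d.+1%:R : R).

Lemma wsum_card : M1 = lam * S (fun I => W I).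
Proof.
transitivity (S (fun I => X I * 1)).
  by apply: eq_wsum => I _; rewrite mulr1.
rewrite wsum_switch; congr (_ * _).
by apply: eq_wsum => I _; rewrite sumr_const.
Qed.

(** Switching with f = X: each of the [W I] addable vertices contributes [X I + 1]. *)
Lemma wsum_card2 : M2 = lam * (S (fun I => X I * W I) + S (fun I => W I)).
Proof.
transitivity (S (fun I => X I * X I)).
  by apply: eq_wsum => I _; rewrite expr2.
rewrite wsum_switch -wsumD; congr (_ * _); apply: eq_wsum => I _.
under eq_bigr => v vU do rewrite (card_setU1_uncovered G v I vU).
by rewrite sumr_const -mulr_natl -natr1; ring.
Qed.

Lemma wsum_card_uncovered :
  lam * (S (fun I => W I ^+ 2) - D * S (fun I => W I)) <=
  S (fun I => X I * W I).
Proof.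
rewrite wsum_switch ler_pM2l // lerBlDr -wsumZ -wsumD.
apply: ler_wsum => // I indI; rewrite -lerBlDr.
have -> : W I ^+ 2 - D * W I = \sum_(v in uncovered G I) (W I - D).
  by rewrite sumr_const -mulr_natl; ring.
apply: ler_sum => v _; rewrite lerBlDr -natrD ler_nat.
exact: uncovered_setU1.
Qed.

(** This is (1 + t) Var X >= E X multiplied by [Z ^+ 2]. The combination [lam * W + t * X] has mean
    (1 + t) E X because lam E W = E X. *)
Lemma variance_mean :
  Z * M1 <= (1 + D * lam) * (Z * M2 - M1 ^+ 2).
Proof.
set t := D * lam.
have t0 : 0 <= t by rewrite mulr_ge0 // ltW.
have := wsum_cauchy R G lam lam_gt0 (fun I => lam * W I + t * X I).
have -> : S (fun I => lam * W I + t * X I) = (1 + t) * M1.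
  by rewrite wsumD !wsumZ -wsum_card; ring.
have -> : S (fun I => (lam * W I + t * X I) ^+ 2) =
    lam ^+ 2 * S (fun I => W I ^+ 2) +
    (2 * lam * t * S (fun I => X I * W I) + t ^+ 2 * M2).
  by rewrite -!wsumZ -!wsumD; apply: eq_wsum => I _; ring.
set A := S (fun I => W I); set B := S (fun I => X I * W I).
set C := S (fun I => W I ^+ 2) => cs.
have e1 : M1 = lam * A := wsum_card.
have e2 : M2 = lam * (B + A) := wsum_card2.
have e3 : lam * (C - D * A) <= B := wsum_card_uncovered.
(* This is [e3] multiplied by [lam], using [lam * B = M2 - M1] and [lam * A = M1]. *)
have e4 : lam ^+ 2 * C <= M2 - M1 + t * M1.
  have := ler_wpM2l (ltW lam_gt0) e3; rewrite e1 e2 /t; lra.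
have Z0 : 0 < Z := indep_poly_gt0 R G lam lam_gt0.
(* After [e4], the bound on the second moment of the combination factors through [1 + t], and one
   such factor cancels at the end. *)
have e5 : ((1 + t) * M1) ^+ 2 <= Z * ((1 + t) * ((1 + t) * M2 - M1)).
  apply: le_trans cs _; rewrite ler_pM2l //.
  apply: (@le_trans _ _ ((M2 - M1 + t * M1) + (2 * lam * t * B + t ^+ 2 * M2))).
    by rewrite lerD2r.
  have -> : 2 * lam * t * B = 2 * t * (M2 - M1) by rewrite e1 e2; ring.
  by rewrite le_eqVlt; apply/orP; left; apply/eqP; ring.
have t1 : 0 < 1 + t by lra.
rewrite -(ler_pM2l t1).
move: e5; rewrite -/t; lra.
Qed.

(** An exact identity rather than a bound, so that the equality case can be read off the right
    side. *)
Lemma mean_gap : (1 + D * lam) * M1 - lam * #|G|%:R * Z =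
  lam * S (fun I => W I + D * X I - #|G|%:R).
Proof.
have -> : S (fun I => W I + D * X I - #|G|%:R) =
    S (fun I => W I) + (D * M1 + - #|G|%:R * Z).
  by rewrite -wsum_indep_poly -!wsumZ -!wsumD; apply: eq_wsum => I _; ring.
by rewrite mulrDl mul1r {1}wsum_card; ring.
Qed.

Lemma card_gap_ge0 I : 0 <= W I + D * X I - #|G|%:R.
Proof.
by rewrite subr_ge0 -natrM -natrD ler_nat (card_uncovered_ge G d I regG).
Qed.

Hypothesis G_gt0 : (0 < #|G|)%N.

Let n0 : 0 < #|G|%:R :> R. Proof. by rewrite ltr0n. Qed.
Let t0 : 0 < 1 + D * lam. Proof. by rewrite ltr_pwDl // mulr_ge0 // ltW. Qed.

(** The excess over the extremal value splits into [e], the normalised slack of [variance_mean], and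
    the normalised slack in the bound on the mean. Both are nonnegative, so equality makes both
    vanish. *)
Lemma variance_fraction_gap : exists2 e, 0 <= e &
  variance_fraction G lam = lam / (1 + D * lam) ^+ 2 + e +
    lam * S (fun I => W I + D * X I - #|G|%:R) /
    (#|G|%:R * (1 + D * lam) ^+ 2 * Z).
Proof.
have Z0 : 0 < Z := indep_poly_gt0 R G lam lam_gt0.
exists (((1 + D * lam) * (Z * M2 - M1 ^+ 2) - Z * M1) /
  (#|G|%:R * (1 + D * lam) * Z ^+ 2)).
  by rewrite divr_ge0 ?subr_ge0 ?variance_mean // !mulr_ge0 ?exprn_ge0 ?ltW.
rewrite variance_fractionE // -mean_gap.
by field; rewrite nat1r !gt_eqF.
Qed.

Lemma variance_fraction_ge :
  lam / (1 + D * lam) ^+ 2 <= variance_fraction G lam.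
Proof.
have Z0 : 0 < Z := indep_poly_gt0 R G lam lam_gt0.
have [e e0 ->] := variance_fraction_gap.
rewrite -addrA lerDl addr_ge0 // divr_ge0 //; last first.
  by rewrite !mulr_ge0 ?exprn_ge0 ?ltW.
by rewrite mulr_ge0 ?(ltW lam_gt0) // wsum_ge0 // => I _; apply: card_gap_ge0.
Qed.

Lemma cluster_of_variance_fraction :
  variance_fraction G lam = lam / (1 + D * lam) ^+ 2 -> cluster_graph G.
Proof.
have Z0 : 0 < Z := indep_poly_gt0 R G lam lam_gt0.
have [e e0 ->] := variance_fraction_gap.
set k := #|G|%:R * _ * _ => E; have k0 : 0 < k by rewrite !mulr_gt0 ?exprn_gt0.
have S0 : 0 <= S (fun I => W I + D * X I - #|G|%:R).
  by rewrite wsum_ge0 // => I _; apply: card_gap_ge0.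
have : lam * S (fun I => W I + D * X I - #|G|%:R) / k <= 0 by lra.
rewrite pmulr_lle0 ?invr_gt0 // pmulr_rle0 // => S0'.
(* A vanishing sum of nonnegative terms has only zero terms; the positive weight then cancels. *)
have gap0 I : I \in indep_sets G -> lam ^+ #|I| * (W I + D * X I - #|G|%:R) = 0.
  move: I; apply: psumr_eq0P => [I _|]; last first.
    by apply/eqP; rewrite eq_le; apply/andP.
  by apply: mulr_ge0; [rewrite exprn_ge0 ?ltW|apply: card_gap_ge0].
apply: (cluster_of_card_uncovered G d regG) => I /gap0/eqP.
rewrite mulf_eq0 expf_eq0 (gt_eqF lam_gt0) andbF /= subr_eq0.
by rewrite -natrM -natrD eqr_nat => /eqP.
Qed.

Lemma variance_fraction_cluster : cluster_graph G ->
  variance_fraction G lam = lam / (1 + D * lam) ^+ 2.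
Proof.
move=> clG; have Z0 : 0 < Z := indep_poly_gt0 R G lam lam_gt0.
have WE I : I \in indep_sets G -> W I = #|G|%:R - D * X I.
  move=> indI; rewrite -(card_uncovered_cluster G d I regG clG indI).
  by rewrite natrD natrM; ring.
have A_E : S (fun I => W I) = #|G|%:R * Z - D * M1.
  transitivity (S (fun I => #|G|%:R * 1 + - D * X I)).
    by apply: eq_wsum => I /WE ->; ring.
  by rewrite wsumD !wsumZ wsum_indep_poly; ring.
have B_E : S (fun I => X I * W I) = #|G|%:R * M1 - D * M2.
  transitivity (S (fun I => #|G|%:R * X I + - D * X I ^+ 2)).
    by apply: eq_wsum => I /WE ->; ring.
  by rewrite wsumD !wsumZ; ring.
(* The switching identities become linear equations: M1 = lam (n Z - D M1), and then M2 = lam (n M1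
   - D M2) + M1, each solved by dividing by 1 + D lam. *)
have M1E : M1 = lam * #|G|%:R * Z / (1 + D * lam).
  have e := wsum_card; rewrite A_E in e.
  apply: (mulIf (lt0r_neq0 t0)); rewrite divfK ?lt0r_neq0 //; lra.
have M2E : M2 = (lam * #|G|%:R * M1 + M1) / (1 + D * lam).
  have e := wsum_card2; rewrite mulrDr -wsum_card B_E in e.
  apply: (mulIf (lt0r_neq0 t0)); rewrite divfK ?lt0r_neq0 //; lra.
rewrite variance_fractionE // M2E M1E.
by field; rewrite nat1r !gt_eqF.
Qed.

End Inequality.

Theorem corollary1p5 (R : realType) (d : nat) (G : sgraph)
    (nonempty_G : (0 < #|G|)%N) (reg_G : regular d G)
    (lam : R) (lam_gt0 : 0 < lam) :
  [/\ variance_fraction (complete_graph d.+1) lam <= variance_fraction G lam,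
      variance_fraction (complete_graph d.+1) lam
        = lam / (1 + d.+1%:R * lam) ^+ 2
    & variance_fraction G lam = variance_fraction (complete_graph d.+1) lam
      <-> exists k : nat, isomorphic G (copies k (complete_graph d.+1))].
Proof.
(* The complete graph is itself a [d]-regular cluster graph, so its value is an instance of the
   equality case. *)
have KE : variance_fraction (complete_graph d.+1) lam =
    lam / (1 + d.+1%:R * lam) ^+ 2.
  apply: (variance_fraction_cluster R d) => //.
  - exact: complete_graph_regular.
  - by rewrite card_ord.
rewrite KE; split; [exact: variance_fraction_ge|by []|].
split=> [eqV|[k isoG]].
  apply: cluster_isomorphic => //.
  exact: cluster_of_variance_fraction eqV.
apply: variance_fraction_cluster => //; apply: isomorphic_cluster isoG _.
by apply: copies_cluster; apply: complete_graph_cluster.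
Qed.
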